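(* Let $n,d\ge 1$ be integers. Starting from $[n]^d$, perform any finite sequence of moves, where each move removes from the current position a vertex having exactly $d$ neighbours in the current position. Then at least $n^{d-1}$ vertices (cubes) are left.
   Context: $[n]^d$ denotes the graph whose vertices (also called cubes) are the $d$-tuples $(x_1,\dots,x_d)$ with $x_i\in\{1,\dots,n\}$; two vertices are neighbours if they differ in exactly one coordinate, and in that coordinate by exactly $1$. A position is any subset of the vertices of $[n]^d$, regarded as an induced subgraph. *)

(* Defs.v *)
From mathcomp Require Import all_boot.

Set Implicit Arguments.
Unset Strict Implicit.
Unset Printing Implicit Defensive.

(* Vertices of [n]^d; the coordinate range {1, ..., n} is shifted to
   {0, ..., n-1}. *)
Definition cube (n d : nat) : finType := {ffun 'I_d -> 'I_n}.

Definition neighbour (n d : nat) : rel (cube n d) := fun x y =>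
  [exists i : 'I_d,
     (((x i).+1 == y i :> nat) || ((y i).+1 == x i :> nat))
     && [forall j : 'I_d, (j != i) ==> (x j == y j)]].

Definition neighbours_in (n d : nat) (P : {set cube n d}) (v : cube n d) :
    {set cube n d} :=
  [set w in P | neighbour v w].

Definition move (n d : nat) : rel {set cube n d} := fun P Q =>
  [exists v in P, (#|neighbours_in P v| == d) && (Q == P :\ v)].

(* Main.v *)
(** A move destroys exactly [d] edges.  Since [[n]^d] has
    [d (n - 1) n^(d-1)] edges, there are at most [(n - 1) n^(d-1)] moves,
    leaving at least [n^d - (n - 1) n^(d-1) = n^(d-1)] vertices. *)
Require Import Defs.
From mathcomp Require Import all_boot.

Section Cubes.

Variables n d : nat.
Implicit Types (P Q : {set cube n d}) (v w x y : cube n d).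

(** Double counting with degree sums, i.e. twice the number of edges. Each move lowers the degree
    sum by exactly [2 * d], so [degree_sum P - 2 * d * #|P|] is invariant ([path_move_degree_sum]).
    The final degree sum is nonnegative, so an upper bound on the edges of the full grid suffices
    ([degree_sumT]). It is obtained one direction at a time: an edge is determined by its lower
    endpoint, which avoids the top facet ([card_up_edges]). *)

Lemma neighbour_sym : symmetric (@neighbour n d).
Proof.
move=> x y; apply: eq_existsb => i; rewrite orbC; congr (_ && _).
by apply: eq_forallb => j; rewrite (eq_sym (x j)).
Qed.

Lemma neighbour_irrefl : irreflexive (@neighbour n d).
Proof.
by move=> x; apply/existsP => -[i]; rewrite orbb gtn_eqF.
Qed.

(* Counts each edge twice. *)
Definition degree_sum P := \sum_(x in P) #|neighbours_in P x|.

(** Deleting [v] loses its own degree, plus one from the degree of each of its neighbours. *)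
Lemma degree_sumD1 P v : v \in P ->
  degree_sum P = (#|neighbours_in P v|).*2 + degree_sum (P :\ v).
Proof.
move=> vP; rewrite /degree_sum (big_setD1 v) //= -addnn -addnA; congr (_ + _).
(* By symmetry, the degree of [v] can be counted from the other endpoints. *)
have -> : #|neighbours_in P v| = \sum_(x in P :\ v) (v \in neighbours_in P x).
  rewrite -big_mkcondr -sum1_card /=; apply: eq_bigl => x.
  rewrite !inE vP neighbour_sym; case: eqVneq => [->|_] //=.
  by rewrite neighbour_irrefl andbF.
rewrite -big_split; apply: eq_bigr => x _.
rewrite (cardsD1 v (neighbours_in P x)); congr (_ + _).
by apply: eq_card => w; rewrite !inE andbA.
Qed.

(** The invariant, written additively to avoid truncated subtraction. *)
Lemma path_move_degree_sum P s : path (@move n d) P s ->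
  degree_sum P + d.*2 * #|last P s| = degree_sum (last P s) + d.*2 * #|P|.
Proof.
elim: s P => [|Q s IHs] P //= /andP[/existsP[v /and3P[vP /eqP Nv /eqP QE]]].
move=> /IHs; rewrite (degree_sumD1 _ _ vP) Nv (cardsD1 v P) vP -QE mulnDr muln1.
by move=> IH; rewrite -addnA IH addnCA.
Qed.

(** Orienting edges upwards lists each edge in direction [i] once. *)
Definition up_edges (i : 'I_d) : {set cube n d * cube n d} :=
  [set p : cube n d * cube n d |
    ((p.1 i).+1 == p.2 i :> nat)
    && [forall j, (j != i) ==> (p.1 j == p.2 j)]].

Lemma card_facet (i : 'I_d) (c : 'I_n) :
  n ^ (d - 1) <= #|[set x : cube n d | x i == c]|.
Proof.
pose f (g : {ffun 'I_d.-1 -> 'I_n}) : cube n d :=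
  [ffun j => if unlift i j is Some k then g k else c].
have f_inj : injective f.
  move=> g h /ffunP fgh; apply/ffunP => k.
  by have := fgh (lift i k); rewrite !ffunE liftK.
have <- : #|{ffun 'I_d.-1 -> 'I_n}| = n ^ (d - 1).
  by rewrite card_ffun !card_ord subn1.
rewrite -(card_imset _ f_inj); apply/subset_leq_card/subsetP => x.
move=> /imsetP[g _ ->].
by rewrite inE ffunE unlift_none.
Qed.

Lemma card_up_edges (i : 'I_d) : 0 < n -> #|up_edges i| + n ^ (d - 1) <= n ^ d.
Proof.
move=> n_gt0; have lt_pred : n.-1 < n by rewrite prednK.
have cardT : #|cube n d| = n ^ d by rewrite card_ffun !card_ord.
rewrite -cardT -(cardsC [set x : cube n d | x i == Ordinal lt_pred]) addnC.
have fst_inj : {in up_edges i &, injective fst}.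
  move=> [x y] [x' y']; rewrite !inE /= => /andP[/eqP yi /forallP yj].
  move=> /andP[/eqP y'i /forallP y'j] xx'; rewrite -{}xx' in y'i y'j *.
  congr pair; apply/ffunP => j; have [->|ji] := eqVneq j i.
    by apply: val_inj; rewrite /= -yi.
  by have := yj j; have := y'j j; rewrite ji => /eqP<- /eqP<-.
rewrite leq_add ?card_facet // -(card_in_imset fst_inj).
apply/subset_leq_card/subsetP => _ /imsetP[[x y] + ->].
rewrite !inE /= => /andP[/eqP yi _].
(* A lower endpoint in the top facet would force [y i = n]. *)
apply: contraTneq (ltn_ord (y i)) => xi.
by rewrite -yi xi /= prednK // ltnn.
Qed.

Lemma degree_sumT : 0 < n ->
  degree_sum [set: cube n d] + d.*2 * n ^ (d - 1) <= d.*2 * n ^ d.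
Proof.
move=> n_gt0.
(* A neighbour [y] of [x] is joined to it by an upward edge, one way or the other, in some
   direction. *)
have degE x : #|neighbours_in [set: cube n d] x|
    <= \sum_i \sum_y (((x, y) \in up_edges i) + ((y, x) \in up_edges i)).
  rewrite exchange_big -sum1_card big_mkcond; apply: leq_sum => y _ /=.
  rewrite !inE /=; case: ifP => // /existsP[i /andP[xyi /forallP xyj]].
  rewrite (bigD1 i) //= !inE /=.
  have -> : [forall j, (j != i) ==> (x j == y j)] by apply/forallP.
  have -> : [forall j, (j != i) ==> (y j == x j)].
    by apply/forallP => j; rewrite (eq_sym (y j)).
  by rewrite !andbT; case/orP: xyi => ->; rewrite ?addn1 ?addnS.
have cardE i : #|up_edges i| = \sum_x \sum_y ((x, y) \in up_edges i).
  rewrite -sum1_card big_mkcond pair_bigA /=.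
  by apply: eq_bigr => -[x y] _; case: ifP.
have leE : degree_sum [set: cube n d] <= \sum_i (#|up_edges i|).*2.
  apply: leq_trans (leq_sum _ (fun x _ => degE x)) _.
  rewrite [leqLHS](eq_bigl xpredT) => [|x]; last by rewrite inE.
  rewrite exchange_big leq_sum // => i _.
  rewrite -addnn cardE [X in _ <= _ + X]exchange_big -big_split /=.
  by apply: leq_sum => x _; rewrite -big_split.
apply: leq_trans (leq_add leE (leqnn _)) _.
have sumE m : d.*2 * m = \sum_(i < d) m.*2.
  by rewrite sum_nat_const card_ord -doubleMl -doubleMr.
rewrite !sumE -big_split leq_sum //= => i _.
by rewrite -doubleD leq_double card_up_edges.
Qed.

End Cubes.

Theorem proposition1 (n d : nat) (hn : 1 <= n) (hd : 1 <= d)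
    (s : seq {set cube n d}) (hs : path (@move n d) [set: cube n d] s) :
  n ^ (d - 1) <= #|last [set: cube n d] s|.
Proof.
have d2_gt0 : 0 < d.*2 by rewrite double_gt0.
(* Scaling by [2 * d] and adding the initial degree sum brings out one side of the invariant. *)
rewrite -(leq_pmul2l d2_gt0) -(leq_add2l (degree_sum _ _ [set: cube n d])).
rewrite (path_move_degree_sum _ _ _ _ hs) cardsT card_ffun !card_ord.
exact: leq_trans (degree_sumT _ _ hn) (leq_addl _ _).
Qed.
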